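(* Let $X,Y,Z,W$ and $S$ be normed spaces, let $f:X\times Y\times Z\longrightarrow W$ be a bounded tri-linear map, and let $m:X\times Y\longrightarrow S$ and $g:S\times Z\longrightarrow W$ be bounded bilinear maps such that $f(x,y,z)=g(m(x,y),z)$ for all $x\in X$, $y\in Y$, $z\in Z$. If $m$ and $g$ are Arens regular, then $f$ is Aron-Berner regular.
   Context: For a normed space $E$, $E^*$ is its (continuous) dual, $E^{**}$ its bidual, and $\langle\cdot,\cdot\rangle$ is the duality pairing (written in either order). Bilinear maps: for normed spaces $A,B,C$ and a bounded bilinear map $m:A\times B\to C$, the adjoint is $m^*:C^*\times A\to B^*$, $\langle m^*(c^*,a),b\rangle=\langle c^*,m(a,b)\rangle$; iterating, $m^{**}=(m^* )^*:B^{**}\times C^*\to A^*$ and $m^{***}=(m^{**})^*:A^{**}\times B^{**}\to C^{**}$. The flip is $m^r:B\times A\to C$, $m^r(b,a)=m(a,b)$, and $m^{r***r}=((m^r)^{***})^r:A^{**}\times B^{**}\to C^{**}$. The map $m$ is Arens regular if $m^{***}=m^{r***r}$. Adjoint of tri-linear maps: for normed spaces $A,B,C,D$ and a bounded tri-linear map $h:A\times B\times C\to D$, the adjoint is the bounded tri-linear map $h^*:D^*\times A\times B\to C^*$ given by $\langle h^*(d^*,a,b),c\rangle=\langle d^*,h(a,b,c)\rangle$. Iterating, $h^{**}=(h^* )^*:C^{**}\times D^*\times A\to B^*$, $h^{***}=(h^{**})^*:B^{**}\times C^{**}\times D^*\to A^*$, and $h^{****}=(h^{***})^*:A^{**}\times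 B^{**}\times C^{**}\to D^{**}$. Flip maps: for a bounded tri-linear $h:A\times B\times C\to D$, define $h^i:B\times A\times C\to D$, $h^i(b,a,c)=h(a,b,c)$; $h^j:A\times C\times B\to D$, $h^j(a,c,b)=h(a,b,c)$; $h^r:C\times B\times A\to D$, $h^r(c,b,a)=h(a,b,c)$; $h^t:C\times A\times B\to D$, $h^t(c,a,b)=h(a,b,c)$; $h^s:B\times C\times A\to D$, $h^s(b,c,a)=h(a,b,c)$. Superscripts are applied successively from left to right, e.g. $f^{t****s}=((f^t)^{****})^s$. The six natural extensions of $f:X\times Y\times Z\to W$ are the maps $f^{****},f^{i****i},f^{j****j},f^{r****r},f^{t****s},f^{s****t}:X^{**}\times Y^{**}\times Z^{**}\to W^{**}$. The map $f$ is called Aron-Berner regular if all six natural extensions are equal: $f^{i****i}=f^{j****j}=f^{r****r}=f^{****}=f^{t****s}=f^{s****t}$. *)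

(* Defs.v *)
From HB Require Import structures.
From mathcomp Require Import all_boot all_order all_algebra.
From mathcomp Require Import complex.
From mathcomp Require Import mathcomp_extra boolp classical_sets functions reals.
From mathcomp Require Import topology normedtype.

Set Implicit Arguments.
Unset Strict Implicit.
Unset Printing Implicit Defensive.

Import Order.TTheory GRing.Theory Num.Theory.
Import numFieldNormedType.Exports.

Local Open Scope classical_set_scope.
Local Open Scope ring_scope.

(* Scalars.  Normed spaces are taken over an arbitrary field K of real or
   complex scalars: a numFieldType whose real elements satisfy the least upper
   bound property.  Up to isomorphism these are the reals and the complex
   numbers (by Gelfand-Mazur), and both are given as instances below.
   Completeness is what makes the operator norm on a dual space exist. *)
HB.mixin Record NumField_isRealComplete K & Num.NumField K := {
  real_supremums : forall A : set K,
    A `<=` [set x | x \is Num.real] -> has_sup A -> supremums A !=set0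
}.

#[short(type="scalarFieldType")]
HB.structure Definition ScalarField :=
  {K of NumField_isRealComplete K & Num.NumField K}.

Lemma realType_supremums (R : realType) (A : set R) :
  A `<=` [set x | x \is Num.real] -> has_sup A -> supremums A !=set0.
Proof.
move=> _ supA; exists (sup A); split; first exact: sup_upper_bound.
by move=> x Ax; apply: ge_sup => //; case: supA.
Qed.

#[non_forgetful_inheritance]
HB.instance Definition _ (R : realType) :=
  NumField_isRealComplete.Build R (@realType_supremums R).

Lemma complex_supremums (R : realType) (A : set R[i]) :
  A `<=` [set x | x \is Num.real] -> has_sup A -> supremums A !=set0.
Proof.
move=> Areal [[a Aa] [u uA]].
have AIm x : A x -> complex.Im x = 0.
  by move=> /Areal /=; case: x => re im; rewrite complex_real => /eqP.
pose B := [set complex.Re x | x in A].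
have supB : has_sup B.
  split; first by exists (complex.Re a), a.
  exists (complex.Re u) => _ [x Ax <-].
  by have := uA x Ax; rewrite lecE => /andP[].
exists (real_complex R (sup B)); split.
  move=> x Ax; rewrite lecE /= AIm // eqxx /=.
  by apply: sup_upper_bound => //; exists x.
move=> x xA; have := xA a Aa; rewrite !lecE /= (AIm a Aa) => /andP[-> _] /=.
apply: ge_sup; first by case: supB.
by move=> _ [y Ay <-]; have := xA y Ay; rewrite lecE => /andP[].
Qed.

HB.instance Definition _ (R : realType) :=
  NumField_isRealComplete.Build R[i] (@complex_supremums R).

Section Dual.
Context {K : scalarFieldType} (E : normedModType K).

Definition dual_pred : {pred E -> K^o} :=
  mem [set f : E -> K^o | linear f /\ continuous f].

Lemma dual_pred_submod : submod_closed dual_pred.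
Proof.
split.
  rewrite inE; split=> [a x y|]; first by rewrite [LHS]/= scaler0 addr0.
  by move=> x; exact: cvg_cst.
move=> a f g; rewrite !inE => -[fl fc] [gl gc]; split.
  move=> b x y.
  change (a *: f (b *: x + y) + g (b *: x + y) =
          b *: (a *: f x + g x) + (a *: f y + g y)).
  rewrite fl gl !scalerDr !scalerA (mulrC a b) -!addrA; congr (_ + _).
  by rewrite addrCA.
move=> x; apply: (@continuousD K K^o E (fun y => a *: f y) g).
  by apply: cvgZl_tmp; exact: fc.
exact: gc.
Qed.

HB.instance Definition _ :=
  GRing.isSubmodClosed.Build K (E -> K^o) dual_pred dual_pred_submod.

Record dual := Dual { dual_fun :> E -> K^o; _ : dual_fun \in dual_pred }.

HB.instance Definition _ := [isSub for dual_fun].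
HB.instance Definition _ := [Choice of dual by <:].
HB.instance Definition _ := [SubChoice_isSubLmodule of dual by <:].


Lemma dualP (f : dual) : linear f /\ continuous f.
Proof. by case: f => f /=; rewrite inE. Qed.

HB.instance Definition _ (f : dual) :=
  GRing.isLinear.Build K E K^o *:%R f (dualP f).1.

Lemma bounded_dual (f : E -> K^o) (M : K) : linear f ->
  (forall x, `|f x| <= M * `|x|) -> f \in dual_pred.
Proof.
move=> fl fM; rewrite inE; split=> //.
pose fL := GRing.isLinear.Build K E K^o *:%R f fl.
pose g : {linear E -> K^o} := HB.pack f fL.
apply: (@bounded_linear_continuous K E K^o g); apply/bounded_funP => r.
have [r0|r0] := boolP (0 <= r); last first.
  exists 0 => x xr; suff: 0 <= r by rewrite (negbTE r0).
  exact: le_trans xr.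
exists (`|M| * r) => x xr; rewrite -[leLHS]normr_id.
apply: (@le_trans _ _ `|M * `|x| |).
  have := fM x; rewrite [leLHS in _ -> leLHS <= _]normr_id.
  by move=> h; rewrite [leRHS]ger0_norm // (le_trans _ h).
by rewrite normrM normr_id ler_wpM2l.
Qed.

Definition opnorm (f : dual) : K :=
  supremum 0 [set `|f x| | x in [set x : E | `|x| <= 1]].

Lemma opnorm_supremums (f : dual) :
  supremums [set `|f x| | x in [set x : E | `|x| <= 1]] (opnorm f).
Proof.
rewrite /opnorm /supremum; set A := [set _ | _ in _].
have A0 : A 0 by exists 0; rewrite /= ?normr0 ?ler01 // linear0 normr0.
have [A_eq0|_] := eqVneq A set0; first by move: A0; rewrite A_eq0.
apply: xgetPex; apply: real_supremums.
  by move=> _ [x _ <-]; exact: normr_real.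
split; first by exists 0.
have /bounded_funP /(_ 1) [M fM] :=
  (continuous_linear_bounded 0 ((dualP f).2 0)).
by exists M => _ [x /= x1 <-]; exact: fM.
Qed.

Implicit Types f g : dual.

Lemma opnorm_ge0 f : 0 <= opnorm f.
Proof.
have [+ _] := opnorm_supremums f; apply.
by exists 0; rewrite /= ?normr0 ?ler01 // linear0 normr0.
Qed.

Lemma le_opnorm f x : `|f x| <= opnorm f * `|x|.
Proof.
have [->|x0] := eqVneq x 0; first by rewrite linear0 !normr0 mulr0.
have nx : 0 < `|x| by rewrite normr_gt0.
rewrite -ler_pdivrMr //; have [+ _] := opnorm_supremums f; apply.
exists (`|x|^-1 *: x) => /=.
  by rewrite normrZ normfV normr_id mulVf ?lt0r_neq0.
by rewrite linearZ (@normrZ K K^o) normfV normr_id mulrC.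
Qed.

Lemma opnorm_le f M :
  0 <= M -> (forall x, `|f x| <= M * `|x|) -> opnorm f <= M.
Proof.
move=> M0 fM; have [_ +] := opnorm_supremums f; apply.
by move=> _ [x /= x1 <-]; apply: le_trans (fM x) _; rewrite ler_piMr.
Qed.

Lemma opnormD f g : opnorm (f + g) <= opnorm f + opnorm g.
Proof.
apply: opnorm_le => [|x]; first by rewrite addr_ge0 ?opnorm_ge0.
rewrite mulrDl; apply: le_trans (ler_normD _ _) _.
by rewrite lerD ?le_opnorm.
Qed.

Lemma opnormZ a f : opnorm (a *: f) = `|a| * opnorm f.
Proof.
have leZ b g : opnorm (b *: g) <= `|b| * opnorm g.
  apply: opnorm_le => [|x]; first by rewrite mulr_ge0 ?opnorm_ge0.
  by rewrite -mulrA (@normrZ K K^o) ler_wpM2l ?le_opnorm.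
apply/eqP; rewrite eq_le leZ /=; have [->|a0] := eqVneq a 0.
  by rewrite normr0 mul0r opnorm_ge0.
rewrite -ler_pdivlMl ?normr_gt0 // -normfV.
by apply: le_trans (leZ _ _); rewrite scalerA mulVf // scale1r.
Qed.

Lemma opnorm_eq0 f : opnorm f = 0 -> f = 0.
Proof.
move=> f0; apply/val_inj/funext => x /=; apply/eqP.
by have := le_opnorm f x; rewrite f0 mul0r normr_le0.
Qed.

HB.instance Definition _ :=
  Lmodule_isNormed.Build K dual opnormD opnormZ opnorm_eq0.

Lemma le_dual_norm (f : dual) x : `|f x| <= `|f| * `|x|.
Proof. exact: le_opnorm. Qed.

End Dual.

Arguments dual_pred {K} E.

Section Bilinear.
Context {K : scalarFieldType}.

Record bilin (A B C : normedModType K) := Bilin {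
  bilin_fun :> A -> B -> C;
  bilin_linear : bilinear_for *:%R *:%R bilin_fun;
  bilin_bounded : exists2 M : K, 0 <= M &
    forall a b, `|bilin_fun a b| <= M * `|a| * `|b|
}.

Section Adjoint.
Context {A B C : normedModType K} (m : bilin A B C).

Lemma bil_adj_subproof (phi : dual C) (a : A) :
  (fun b => phi (m a b)) \in dual_pred B.
Proof.
have [M M0 mM] := bilin_bounded m.
apply: (@bounded_dual _ _ _ (`|phi| * (M * `|a|))) => [k x y|b].
  by rewrite (bilin_linear m).2 linearP.
apply: le_trans (le_dual_norm _ _) _.
by rewrite -[leRHS]mulrA ler_wpM2l.
Qed.

Definition bil_adj_fun (phi : dual C) (a : A) : dual B :=
  Dual (bil_adj_subproof phi a).

Lemma bil_adj_linear : bilinear_for *:%R *:%R bil_adj_fun.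
Proof.
split=> [a k phi psi|phi k a a']; apply/val_inj/funext => b //=.
by rewrite (bilin_linear m).1 linearP.
Qed.

Lemma bil_adj_bounded : exists2 M : K, 0 <= M &
  forall phi a, `|bil_adj_fun phi a| <= M * `|phi| * `|a|.
Proof.
have [M M0 mM] := bilin_bounded m; exists M => // phi a.
apply: opnorm_le => [|b]; first by rewrite !mulr_ge0.
apply: le_trans (le_dual_norm phi _) _.
by rewrite (mulrC M) -!mulrA ler_wpM2l // mulrA.
Qed.

Definition bil_adj : bilin (dual C) A (dual B) :=
  Bilin bil_adj_linear bil_adj_bounded.

Lemma bil_flip_linear : bilinear_for *:%R *:%R (fun b a => m a b).
Proof. by have [ml mr] := bilin_linear m. Qed.

Lemma bil_flip_bounded : exists2 M : K, 0 <= M &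
  forall b a, `|m a b| <= M * `|b| * `|a|.
Proof.
have [M M0 mM] := bilin_bounded m; exists M => // b a.
by rewrite mulrAC.
Qed.

Definition bil_flip : bilin B A C := Bilin bil_flip_linear bil_flip_bounded.

End Adjoint.

Definition bil_adj3 {A B C : normedModType K} (m : bilin A B C) :
    bilin (dual (dual A)) (dual (dual B)) (dual (dual C)) :=
  bil_adj (bil_adj (bil_adj m)).

Definition Arens_regular {A B C : normedModType K} (m : bilin A B C) : Prop :=
  forall a b, bil_adj3 m a b = bil_flip (bil_adj3 (bil_flip m)) a b.

End Bilinear.

Section Trilinear.
Context {K : scalarFieldType}.

Definition trilinear_for {A B C D : normedModType K} (h : A -> B -> C -> D) :=
  [/\ forall b c, linear (fun a => h a b c),
      forall a c, linear (fun b => h a b c) &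
      forall a b, linear (fun c => h a b c)].

Record trilin (A B C D : normedModType K) := Trilin {
  trilin_fun :> A -> B -> C -> D;
  trilin_linear : trilinear_for trilin_fun;
  trilin_bounded : exists2 M : K, 0 <= M &
    forall a b c, `|trilin_fun a b c| <= M * `|a| * `|b| * `|c|
}.

Section Adjoint.
Context {A B C D : normedModType K} (h : trilin A B C D).

Lemma tri_adj_subproof (phi : dual D) (a : A) (b : B) :
  (fun c => phi (h a b c)) \in dual_pred C.
Proof.
have [M M0 hM] := trilin_bounded h; have [_ _ hl] := trilin_linear h.
apply: (@bounded_dual _ _ _ (`|phi| * (M * `|a| * `|b|))) => [k x y|c].
  by rewrite hl linearP.
apply: le_trans (le_dual_norm _ _) _.
by rewrite -[leRHS]mulrA ler_wpM2l.
Qed.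

Definition tri_adj_fun (phi : dual D) (a : A) (b : B) : dual C :=
  Dual (tri_adj_subproof phi a b).

Lemma tri_adj_linear : trilinear_for tri_adj_fun.
Proof.
have [h1 h2 _] := trilin_linear h.
split=> [a b k phi psi|phi b k a a'|phi a k b b'];
  apply/val_inj/funext => c //=.
- by rewrite h1 linearP.
- by rewrite h2 linearP.
Qed.

Lemma tri_adj_bounded : exists2 M : K, 0 <= M &
  forall phi a b, `|tri_adj_fun phi a b| <= M * `|phi| * `|a| * `|b|.
Proof.
have [M M0 hM] := trilin_bounded h; exists M => // phi a b.
apply: opnorm_le => [|c]; first by rewrite !mulr_ge0.
apply: le_trans (le_dual_norm phi _) _.
by rewrite (mulrC M) -!mulrA ler_wpM2l // !mulrA.
Qed.

Definition tri_adj : trilin (dual D) A B (dual C) :=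
  Trilin tri_adj_linear tri_adj_bounded.

End Adjoint.

Definition tri_adj4 {A B C D : normedModType K} (h : trilin A B C D) :
    trilin (dual (dual A)) (dual (dual B)) (dual (dual C)) (dual (dual D)) :=
  tri_adj (tri_adj (tri_adj (tri_adj h))).

Section Flips.
Context {A B C D : normedModType K} (h : trilin A B C D).

Lemma flip_i_subproof : trilinear_for (fun b a c => h a b c).
Proof. by have [] := trilin_linear h. Qed.
Lemma flip_i_bounded : exists2 M : K, 0 <= M &
  forall b a c, `|h a b c| <= M * `|b| * `|a| * `|c|.
Proof.
have [M M0 hM] := trilin_bounded h; exists M => // b a c.
by rewrite (mulrAC M).
Qed.
Definition flip_i : trilin B A C D := Trilin flip_i_subproof flip_i_bounded.

Lemma flip_j_subproof : trilinear_for (fun a c b => h a b c).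
Proof. by have [] := trilin_linear h. Qed.
Lemma flip_j_bounded : exists2 M : K, 0 <= M &
  forall a c b, `|h a b c| <= M * `|a| * `|c| * `|b|.
Proof.
have [M M0 hM] := trilin_bounded h; exists M => // a c b.
by rewrite (mulrAC (M * _)).
Qed.
Definition flip_j : trilin A C B D := Trilin flip_j_subproof flip_j_bounded.
End Flips.

Section Flips3.
Context {A B C D : normedModType K} (h : trilin A B C D).

Lemma flip_r_subproof : trilinear_for (fun c b a => h a b c).
Proof. by have [] := trilin_linear h. Qed.
Lemma flip_r_bounded : exists2 M : K, 0 <= M &
  forall c b a, `|h a b c| <= M * `|c| * `|b| * `|a|.
Proof.
by have [M M0 hM] := trilin_bounded (flip_i (flip_j (flip_i h))); exists M. Qed.
Definition flip_r : trilin C B A D := Trilin flip_r_subproof flip_r_bounded.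

Lemma flip_t_subproof : trilinear_for (fun c a b => h a b c).
Proof. by have [] := trilin_linear h. Qed.
Lemma flip_t_bounded : exists2 M : K, 0 <= M &
  forall c a b, `|h a b c| <= M * `|c| * `|a| * `|b|.
Proof.
by have [M M0 hM] := trilin_bounded (flip_i (flip_j h)); exists M. Qed.
Definition flip_t : trilin C A B D := Trilin flip_t_subproof flip_t_bounded.

Lemma flip_s_subproof : trilinear_for (fun b c a => h a b c).
Proof. by have [] := trilin_linear h. Qed.
Lemma flip_s_bounded : exists2 M : K, 0 <= M &
  forall b c a, `|h a b c| <= M * `|b| * `|c| * `|a|.
Proof.
by have [M M0 hM] := trilin_bounded (flip_j (flip_i h)); exists M. Qed.
Definition flip_s : trilin B C A D := Trilin flip_s_subproof flip_s_bounded.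
End Flips3.

(* Superscripts act from left to right: the extension f^{t****s} is
   flip_s (tri_adj4 (flip_t f)). *)
Definition Aron_Berner_regular {A B C D : normedModType K}
    (f : trilin A B C D) : Prop :=
  forall (a : dual (dual A)) (b : dual (dual B)) (c : dual (dual C)),
  [/\ flip_i (tri_adj4 (flip_i f)) a b c = tri_adj4 f a b c,
      flip_j (tri_adj4 (flip_j f)) a b c = tri_adj4 f a b c,
      flip_r (tri_adj4 (flip_r f)) a b c = tri_adj4 f a b c,
      flip_s (tri_adj4 (flip_t f)) a b c = tri_adj4 f a b c &
      flip_t (tri_adj4 (flip_s f)) a b c = tri_adj4 f a b c].

End Trilinear.

(* Main.v *)
Require Import Defs.
From mathcomp Require Import all_boot all_order all_algebra.
From mathcomp Require Import boolp.
From mathcomp Require Import reals topology normedtype.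

(** The six extensions of [f] are the six iterated weak-star limits of
    [g (m x y) z].  When [z] is the innermost or the outermost variable, the
    limit is an Arens extension of [g] applied to one of [m].  When [z] is the
    middle one, regularity of [g], applied with the outer variable fixed,
    exchanges the two inner limits and reduces to the case of [z] innermost. *)

Section Factorization.
Context {K : scalarFieldType}.

Lemma dual_ext (E : normedModType K) (phi psi : dual E) :
  phi =1 psi -> phi = psi.
Proof. by move=> eq_phi; apply/val_inj/funext. Qed.

Context {A B C D S : normedModType K}.

(** Peeling off [a], [b], [c] in turn leaves only the identity [hE] under [w]. *)
Lemma tri_adj4_factorl (h : trilin A B C D) (m : bilin A B S)
    (g : bilin S C D) (hE : forall a b c, h a b c = g (m a b) c)
    (a : dual (dual A)) (b : dual (dual B)) (c : dual (dual C)) :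
  tri_adj4 h a b c = bil_adj3 g (bil_adj3 m a b) c.
Proof.
apply: dual_ext => w /=; congr (a _).
apply: dual_ext => x /=; congr (b _).
apply: dual_ext => y /=; congr (c _).
by apply: dual_ext => z /=; rewrite hE.
Qed.

(** Serves the orders with [z] outermost, where [g] enters flipped. *)
Lemma tri_adj4_factorr (h : trilin A B C D) (m : bilin B C S)
    (g : bilin A S D) (hE : forall a b c, h a b c = g a (m b c))
    (a : dual (dual A)) (b : dual (dual B)) (c : dual (dual C)) :
  tri_adj4 h a b c = bil_adj3 g a (bil_adj3 m b c).
Proof.
apply: dual_ext => w /=; congr (a _).
apply: dual_ext => x /=; congr (b _).
apply: dual_ext => y /=; congr (c _).
by apply: dual_ext => z /=; rewrite hE.
Qed.

Lemma tri_adj4_factor_mid (h : trilin A C B D) (m : bilin A B S)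
    (g : bilin S C D) (hE : forall a c b, h a c b = g (m a b) c)
    (g_regular : Arens_regular g)
    (a : dual (dual A)) (b : dual (dual B)) (c : dual (dual C)) :
  tri_adj4 h a c b = bil_adj3 g (bil_adj3 m a b) c.
Proof.
apply: dual_ext => w /=; congr (a _).
apply: dual_ext => x /=.
(* [mxb] is [m***(x, b)], with [x] seen in the bidual of [A]. *)
pose mxb : dual (dual S) := bil_adj (bil_flip (bil_adj m)) b x.
transitivity (bil_adj3 g mxb c w); last by [].
(* Regularity of [g] at [mxb] and [c] moves [c] outside [b], the order found on the left. *)
rewrite g_regular /=; congr (c _).
apply: dual_ext => z /=; congr (b _).
by apply: dual_ext => y /=; rewrite hE.
Qed.

End Factorization.

Theorem theorem2p6 (K : scalarFieldType) (X Y Z W S : normedModType K)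
    (f : trilin X Y Z W) (m : bilin X Y S) (g : bilin S Z W)
    (f_factor : forall x y z, f x y z = g (m x y) z)
    (m_regular : Arens_regular m) (g_regular : Arens_regular g) :
  Aron_Berner_regular f.
Proof.
move=> a b c.
(* Regularity as used below: the extension of a flipped factor is the flip of its extension. *)
have mE : bil_adj3 (bil_flip m) b a = bil_adj3 m a b by rewrite m_regular.
have gE s : bil_adj3 (bil_flip g) c s = bil_adj3 g s c by rewrite g_regular.
rewrite (tri_adj4_factorl f m g f_factor); split.
- rewrite -mE; apply: (tri_adj4_factorl (flip_i f) (bil_flip m) g) => y x z.
  exact: f_factor.
- by apply: (tri_adj4_factor_mid (flip_j f) m g) => // x z y; exact: f_factor.
- rewrite -mE -gE.
  apply: (tri_adj4_factorr (flip_r f) (bil_flip m) (bil_flip g)) => z y x.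
  exact: f_factor.
- rewrite -gE; apply: (tri_adj4_factorr (flip_t f) m (bil_flip g)) => z x y.
  exact: f_factor.
(* The order [y], [z], [x] uses both hypotheses: [g_regular] moves [z] innermost and [mE] swaps [x]
   and [y]. *)
- rewrite -mE; apply: (tri_adj4_factor_mid (flip_s f) (bil_flip m) g) => //.
  by move=> y z x; exact: f_factor.
Qed.
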